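(* Assume $\Delta=\sup_{x,y\in\mathbb R^k}|\ell(x)-\ell(y)|<\infty$, and let $\epsilon>0$. Then the DP-CUSUM stopping time $\tilde T(b)$ (for any deterministic threshold $b$) is $\epsilon$-differentially private in the following sense: for every $n\ge 1$ and every pair of neighboring data sequences $X_{(1:n)}=(X_1,\dots,X_n)$ and $X'_{(1:n)}=(X'_1,\dots,X'_n)$ (fixed sequences in $\mathbb R^k$ differing in at most one entry), $$\mathbf P_{\tilde T}\big(\tilde T(b)=n\mid X_{(1:n)}\big)\le e^{\epsilon}\,\mathbf P_{\tilde T}\big(\tilde T(b)=n\mid X'_{(1:n)}\big),$$ where $\mathbf P_{\tilde T}$ is the probability over the internal randomness of the procedure only (the Laplace noises), with the data held fixed.
   Context: Let $f_0\ne f_1$ be two known distinct probability density functions on $\mathbb R^k$ (pre- and post-change densities) and let $\ell(x)=\log(f_1(x)/f_0(x))$ be the log-likelihood ratio. For a data sequence $X_1,X_2,\ldots\in\mathbb R^k$, the CUSUM statistics are $S_0=0$ and, for $t\ge1$, $$S_t=\max_{1\le k\le t}\sum_{j=k}^t\ell(X_j)=\max(0,S_{t-1})+\ell(X_t).$$ $\mathrm{Lap}(\beta)$ denotes the Laplace distribution with density $\exp(-|x|/\beta)/(2\beta)$, $\beta>0$. The DP-CUSUM procedure uses $\tilde S_t=S_t+Z_t$, where $Z_1,Z_2,\ldots$ are i.i.d. $\mathrm{Lap}(2\Delta/\epsilon)$, and a single $W\sim\mathrm{Lap}(2\Delta/\epsilon)$; $(Z_t)_{t\ge1}$, $W$ and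 the data are mutually independent. The stopping time with deterministic threshold $b$ is $$\tilde T(b)=\inf\{t>0:\tilde S_t\ge b+W\}.$$ The event $\{\tilde T(b)=n\}$ depends only on $X_1,\dots,X_n$, $Z_1,\dots,Z_n$ and $W$. *)

(* Defs.v *)
From HB Require Import structures.
From mathcomp Require Import all_boot all_order all_algebra.
From mathcomp Require Import all_classical all_reals all_analysis.

Set Implicit Arguments.
Unset Strict Implicit.
Unset Printing Implicit Defensive.

Import Order.TTheory GRing.Theory Num.Theory.
Import numFieldNormedType.Exports.

Local Open Scope classical_set_scope.
Local Open Scope ring_scope.

Section lebesgue_cons.
Context {R : realType} {k : nat}.
Local Notation RR := (measurableTypeR R).
Variable m : {sigma_finite_measure set (k.-tuple RR) -> \bar R}.

Let tcons (z : RR * k.-tuple RR) := [tuple of z.1 :: z.2].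

(* The product of [lebesgue_measure] and [m], transported from R * R^k to
   R^k.+1 along (x, v) |-> x :: v. *)
Definition lebesgue_cons : set (k.+1.-tuple RR) -> \bar R :=
  pushforward (lebesgue_measure \x m)%E tcons.

Let measurable_tcons : measurable_fun setT tcons.
Proof. exact: measurable_cons. Qed.

Let lebesgue_cons0 : lebesgue_cons set0 = 0%E.
Proof. exact: measure0. Qed.

Let lebesgue_cons_ge0 A : (0 <= lebesgue_cons A)%E.
Proof. exact: measure_ge0. Qed.

Let lebesgue_cons_sigma_additive : semi_sigma_additive lebesgue_cons.
Proof.
move=> F mF tF mUF; rewrite /lebesgue_cons /pushforward preimage_bigcup.
apply: measure_semi_sigma_additive.
- by move=> n; rewrite -[X in measurable X]setTI; exact: measurable_tcons.
- apply/trivIsetP => /= a b _ _ ab; rewrite -preimage_setI.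
  by move/trivIsetP : tF => /(_ _ _ _ _ ab) ->//; rewrite preimage_set0.
- by rewrite -preimage_bigcup -[X in measurable X]setTI; exact: measurable_tcons.
Qed.

HB.instance Definition _ := isMeasure.Build _ _ _ lebesgue_cons
  lebesgue_cons0 lebesgue_cons_ge0 lebesgue_cons_sigma_additive.

Lemma lebesgue_consE (A : set R) (B : set (k.-tuple R)) :
  measurable A -> measurable B ->
  lebesgue_cons [set v | A (thead v) /\ B [tuple of behead v]] =
  (lebesgue_measure A * m B)%E.
Proof.
move=> mA mB; rewrite /lebesgue_cons /pushforward -product_measure1E//.
congr ((_ \x _)%E _); apply/seteqP; split=> -[x v] /= [Ax Bv]; split=> //.
  by move: Bv; congr B; exact: val_inj.
by move: Bv; congr B; exact: val_inj.
Qed.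

Let lebesgue_cons_sigma_finite : sigma_finite setT lebesgue_cons.
Proof.
have /sigma_finiteP[F [FT ndF Foo]] := sigma_finiteT (@lebesgue_measure R).
have /sigma_finiteP[G [GT ndG Goo]] := sigma_finiteT m.
exists (fun i => [set v | F i (thead v) /\ G i [tuple of behead v]]).
  apply/esym/seteqP; split=> // v _.
  have [i _ Fi] : (\bigcup_i F i) (thead v) by rewrite -FT.
  have [j _ Gj] : (\bigcup_i G i) [tuple of behead v] by rewrite -GT.
  exists (maxn i j) => //=; split.
    by move: (thead v) Fi; exact/subsetPset/ndF/leq_maxl.
  by move: [tuple of behead v] Gj; exact/subsetPset/ndG/leq_maxr.
move=> i; have [[mF Fi] [mG Gi]] := (Foo i, Goo i); split.
  apply: measurableI; rewrite -[X in measurable X]setTI.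
    exact: (measurable_tnth ord0).
  exact: measurable_behead.
by rewrite lebesgue_consE// lte_mul_pinfty// ge0_fin_numE.
Qed.

HB.instance Definition _ := Measure_isSigmaFinite.Build _ _ _ lebesgue_cons
  lebesgue_cons_sigma_finite.

End lebesgue_cons.

(* R^k is [k.-tuple R] with the product sigma-algebra of the library; this is
   Lebesgue measure on it. *)
Fixpoint lebesgue_tuple {R : realType} (k : nat) :
    {sigma_finite_measure set (k.-tuple (measurableTypeR R)) -> \bar R} :=
  match k with
  | 0 => \d_ ([tuple] : 0.-tuple (measurableTypeR R))
  | k'.+1 => lebesgue_cons (lebesgue_tuple k')
  end.

Lemma lebesgue_tuple_box {R : realType} (k : nat) (A : 'I_k -> set R) :
  (forall i, measurable (A i)) ->
  lebesgue_tuple k [set v | forall i, A i (tnth v i)] =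
  (\prod_(i < k) lebesgue_measure (A i))%E.
Proof.
elim: k A => [|k IH] A mA.
  by rewrite big_ord0 /= diracE mem_set// => -[].
rewrite big_ord_recl -IH; last by move=> i; exact: mA.
rewrite -lebesgue_consE//.
- congr (lebesgue_cons _ _); apply/seteqP; split=> v /=.
    by move=> Av; split=> [|i]; [|have := Av (lift ord0 i)];
      [exact: (Av ord0)|rewrite [in X in X -> _](tuple_eta v) tnthS].
  move=> [A0 Av] i; case: (unliftP ord0 i) => [j ->|->]//.
  by rewrite (tuple_eta v) tnthS; exact: Av.
- rewrite (_ : [set _ | _] = \bigcap_(i in [set: 'I_k])
    (fun v : k.-tuple (measurableTypeR R) => tnth v i) @^-1` A (lift ord0 i)).
    apply: fin_bigcap_measurable => // i _; rewrite -[X in measurable X]setTI.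
    by apply: measurable_tnth => //; exact: mA.
  by apply/seteqP; split=> v Av i; [move=> _|]; exact: Av.
Qed.

(* The maximum runs over the nonempty range 1 <= m <= t; its default value
   l (X t) is the term m = t, so it does not change the maximum. *)
Definition cusum {R : realType} {T : Type} (l : T -> R) (X : nat -> T)
    (t : nat) : R :=
  if t is 0 then 0
  else \big[Num.max/l (X t)]_(1 <= m < t.+1) \sum_(m <= j < t.+1) l (X j).

Lemma cusumS {R : realType} {T : Type} (l : T -> R) (X : nat -> T) (t : nat) :
  cusum l X t.+1 = Num.max 0 (cusum l X t) + l (X t.+1).
Proof.
have shift (c : R) (r : seq nat) (F : nat -> R) :
    \big[Num.max/c]_(m <- r) (F m + c) = \big[Num.max/0]_(m <- r) F m + c.
  by elim: r => [|a r IH]; rewrite ?big_nil ?add0r// !big_cons IH addr_maxl.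
have recr (x : R) (u : nat) (F : nat -> R) :
    \big[Num.max/x]_(1 <= m < u.+2) F m =
    \big[Num.max/Num.max (F u.+1) x]_(1 <= m < u.+1) F m.
  have -> : index_iota 1 u.+2 = index_iota 1 u.+1 ++ [:: u.+1].
    by rewrite /index_iota !subn1 /= -(iotaD 1 u 1) addn1.
  by rewrite big_cat_nested big_cons big_nil.
have swap (x y : R) (r : seq nat) (F : nat -> R) :
    Num.max x (\big[Num.max/y]_(m <- r) F m) = \big[Num.max/Num.max x y]_(m <- r) F m.
  by elim: r => [|a r IH]; rewrite ?big_nil// !big_cons -IH maxCA.
rewrite {1}/cusum recr big_nat1 maxxx.
under eq_big_nat => m /andP[_ mt] do rewrite big_nat_recr ?(ltnW mt)//=.
rewrite shift; congr (_ + _); case: t => [|t]; first by rewrite big_geq// maxxx.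
by rewrite /cusum !recr swap !big_nat1 maxxx maxC.
Qed.

Definition is_density {d} {T : measurableType d} {R : realType}
    (mu : {measure set T -> \bar R}) (f : T -> R) : Prop :=
  [/\ measurable_fun setT f, forall x, 0 <= f x &
      (\int[mu]_x (f x)%:E = 1)%E].

Definition llr {T : Type} {R : realType} (f0 f1 : T -> R) (x : T) : R :=
  ln (f1 x / f0 x).

Definition laplace_pdf {R : realType} (beta x : R) : R :=
  expR (- `|x| / beta) / (2 * beta).

Definition laplace_distributed {d} {T : measurableType d} {R : realType}
    {P : probability T R} (beta : R) (X : {RV P >-> R}) : Prop :=
  forall A : set R, measurable A ->
    distribution P X A = (\int[lebesgue_measure]_(x in A) (laplace_pdf beta x)%:E)%E.

Definition mutually_independent {d} {T : measurableType d} {R : realType}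
    {P : probability T R} {I : eqType} (X : I -> {RV P >-> R}) : Prop :=
  forall (s : seq I) (A : I -> set R), uniq s -> (forall i, measurable (A i)) ->
    P (\bigcap_(i in [set` s]) X i @^-1` A i) =
    (\prod_(i <- s) P (X i @^-1` A i))%E.

(* Position 0 carries W and position t >= 1 carries Z_t; [Z 0] plays no role. *)
Definition noise {d} {T : measurableType d} {R : realType} {P : probability T R}
    (Z : nat -> {RV P >-> R}) (W : {RV P >-> R}) (t : nat) : {RV P >-> R} :=
  if t is 0 then W else Z t.

(* T~(b) for the realization z of (Z_t) and w of W; it is +oo when the
   threshold is never reached. *)
Definition dp_cusum_time {R : realType} {T : Type} (l : T -> R) (b : R)
    (X : nat -> T) (z : nat -> R) (w : R) : \bar R :=
  ereal_inf [set (t%:R)%:E | t in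
    [set t : nat | (0 < t)%N /\ b + w <= cusum l X t + z t]].

(* X_1, ..., X_n and X'_1, ..., X'_n differ in at most one entry. *)
Definition neighboring {T : Type} (n : nat) (X X' : nat -> T) : Prop :=
  exists i : nat, forall t : nat, (0 < t <= n)%N -> t <> i -> X t = X' t.

(* Main.v *)
Require Import Defs.
From HB Require Import structures.
From mathcomp Require Import all_boot all_order all_algebra.
From mathcomp Require Import all_classical all_reals all_analysis.
From mathcomp Require Import measurable_realfun ring lra.
Import Order.TTheory GRing.Theory Num.Theory.
Import numFieldNormedType.Exports.
Local Open Scope classical_set_scope.
Local Open Scope ring_scope.

Set Implicit Arguments.
Unset Strict Implicit.

(** The argument is the privacy proof of the sparse vector (AboveThreshold)
mechanism, sharpened by a monotonicity property of CUSUM.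

Write [S], [S'] for the CUSUM statistics of the two data sequences and
[beta = 2 Delta / eps].  The procedure stops at [n] exactly when
[S t + Z t < b + W] for [0 < t < n] and [b + W <= S n + Z n].  Translating one
Laplace noise by [c] multiplies probabilities by at most [exp (|c| / beta)]
([laplace_coord_shift]), so it suffices to translate [W] and [Z n] so that the
event for [S] becomes contained in the event for [S'].

The general sparse vector argument translates [W] by [Delta], to absorb an
increase of the statistics before [n], and [Z n] by [2 Delta], to absorb both
that translation and a decrease of the statistic at [n]; at the present noise
level this costs [3 eps / 2].  Here the sequences differ in a single entry [i],
so the statistics are ordered the same way at all times: each [S t] is a
nondecreasing function of the log-likelihood ratio at [i], and it moves by at
most [Delta] ([cusum_le_shift]).
- If [S <= S' <= S + Delta], the statistic at [n] does not decrease: translating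
  both [W] and [Z n] by [Delta] is enough, at cost [2 Delta / beta = eps].
- If [S - Delta <= S' <= S], the statistics before [n] do not increase:
  translating [Z n] alone by [Delta] is enough, at cost [eps / 2].

Finally [Delta > 0], so that [beta > 0]: a constant log-likelihood ratio would
make the two densities proportional, hence equal ([is_density_proportional]). *)

(** * Translating one Laplace variable *)

Lemma laplace_pdf_gt0 (R : realType) (beta x : R) :
  0 < beta -> 0 < laplace_pdf beta x.
Proof. by move=> b0; rewrite divr_gt0 ?expR_gt0 ?mulr_gt0. Qed.

Lemma measurable_laplace_pdf (R : realType) (beta : R) :
  measurable_fun [set: measurableTypeR R] (laplace_pdf beta).
Proof.
apply: measurable_funM => //; apply: measurableT_comp => //.
by apply: measurable_funM => //; exact: measurableT_comp.
Qed.

Lemma laplace_pdf_shift (R : realType) (beta c x : R) : 0 < beta ->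
  laplace_pdf beta (x + c) <= expR (`|c| / beta) * laplace_pdf beta x.
Proof.
move=> b0; rewrite mulrA -expRD ler_pM2r ?invr_gt0 ?mulr_gt0// ler_expR.
rewrite -mulrDl ler_pM2r ?invr_gt0// lerNl opprD opprK.
rewrite -{1}(addrK c x); have := ler_normB (x + c) c; lra.
Qed.

Lemma lebesgue_measure_shift (R : realType) (c : R) (A : set R) :
  measurable A ->
  pushforward lebesgue_measure ((fun x => x + c) : _ -> measurableTypeR R) A =
  lebesgue_measure A.
Proof.
move=> mA.
have mD : measurable_fun [set: measurableTypeR R]
  ((fun x => x + c) : _ -> measurableTypeR R) by exact: measurable_funD.
apply/esym/lebesgue_measure_unique => //= _ [[a b]] _ <-.
rewrite /pushforward (_ : _ @^-1` _ = `]a - c, b - c]%classic); last first.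
  by apply/seteqP; split=> x /=; rewrite !in_itv/= ltrBlDr lerBrDr.
rewrite !lebesgue_measure_itv/= !lte_fin ltrD2r -!EFinD.
by congr (if _ then _ else _); congr EFin; lra.
Qed.

(** The pointwise comparison of densities [laplace_pdf_shift], integrated after
the change of variable [y |-> y + c]. *)
Lemma distribution_laplace_shift (R : realType) {d} {T : measurableType d}
    (P : probability T R) (beta c : R) (Y : {RV P >-> R}) (B : set R) :
  0 < beta -> laplace_distributed beta Y -> measurable B ->
  (distribution P Y B <= (expR (`|c| / beta))%:E *
                         distribution P Y ((fun y => (y + c)%R) @^-1` B))%E.
Proof.
move=> b0 Ylap mB.
pose s : R -> measurableTypeR R := fun y => y + c.
have ms : measurable_fun [set: measurableTypeR R] s by exact: measurable_funD.
have msB : measurable (s @^-1` B) by rewrite -[X in measurable X]setTI; exact: ms.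
have mlap D :
    measurable_fun D (fun x : measurableTypeR R => (laplace_pdf beta x)%:E).
  exact: measurable_funS (measurableT_comp _ (@measurable_laplace_pdf R beta)).
have lap0 x : (0 <= (laplace_pdf beta x)%:E)%E by rewrite lee_fin ltW ?laplace_pdf_gt0.
rewrite (Ylap _ mB) (Ylap _ msB).
rewrite (eq_measure_integral (pushforward lebesgue_measure s)); last first.
  by move=> A mA _; apply/esym/lebesgue_measure_shift.
rewrite ge0_integral_pushforward// -ge0_integralZl//.
apply: ge0_le_integral => //.
- by move=> x _ /=; exact: lap0.
- apply: measurable_funS (measurableT_comp _
    (measurableT_comp (@measurable_laplace_pdf R beta) ms)) => //.
- by apply: emeasurable_funM => //; exact: mlap.
- by move=> x _; rewrite -EFinM lee_fin laplace_pdf_shift.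
Qed.

(** * Independence and translation of one coordinate *)

Lemma independent_sigma (R : realType) {d} {T : measurableType d}
    (P : probability T R) (G : set (set T)) (C : set T) :
  G `<=` measurable -> setI_closed G -> G setT -> measurable C ->
  (forall A, G A -> P (A `&` C) = P A * P C)%E ->
  forall A, <<s G >> A -> (P (A `&` C) = P A * P C)%E.
Proof.
move=> Gm GI GT mC indep A GA.
(* Both sides, as functions of A, are finite measures: the restriction of P to
   C and the multiple of P by the number P C. *)
pose r := NngNum (fine_ge0 (measure_ge0 P C)).
have rE : (r%:num%:E = P C)%E by rewrite /= fineK ?fin_num_measure.
suff : mrestr P mC A = mscale r P A by rewrite /mscale rE muleC.
apply: (g_sigma_algebra_measure_unique G Gm (fun=> setT)) => //.
- by rewrite bigcup_const//; exists 0%N.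
- by move=> B GB; rewrite /= /mscale rE muleC; exact: indep.
- move=> _; rewrite /= /mrestr setTI.
  by rewrite (le_lt_trans (probability_le1 P mC)) ?ltry.
Qed.

(** For independent [V] and [Y] the law of the pair is the product measure, whose
value on [E] is the integral of the [Y]-probabilities of the sections of [E]. *)
Lemma joint_lawE (R : realType) {d} {T : measurableType d} (P : probability T R)
    {d1} {T1 : measurableType d1} (V : {RV P >-> T1}) (Y : {RV P >-> R})
    (E : set (T1 * R)) :
  (forall A B, measurable A -> measurable B ->
    P (V @^-1` A `&` Y @^-1` B) = P (V @^-1` A) * P (Y @^-1` B))%E ->
  measurable E ->
  (P [set t | E (V t, Y t)] =
   \int[distribution P V]_x distribution P Y (xsection E x))%E.
Proof.
move=> VY mE.
pose VYpair : T -> T1 * R := fun t => (V t, Y t).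
have mVY : measurable_fun setT VYpair.
  by apply: measurable_fun_pair; exact: measurable_funPT.
pose mVY' := isMeasurableFun.Build _ _ _ _ _ mVY.
pose VY' : {RV P >-> (T1 * R)%type} := HB.pack VYpair mVY'.
transitivity (distribution P VY' E) => //.
by rewrite -(@product_measure_unique _ _ _ _ _ (distribution P V)
  (distribution P Y) (distribution P VY')).
Qed.

(** A pi-system generating the sigma-algebra of all the coordinates but [j]. *)
Definition cylinders {R : realType} {d} {T : measurableType d}
    {P : probability T R} {I : choiceType} (X : I -> {RV P >-> R}) (j : I) :
    set (set T) :=
  [set C | exists s (A : I -> set R), [/\ uniq s, j \notin s,
     forall i, measurable (A i) & C = \bigcap_(i in [set` s]) X i @^-1` A i]].

Lemma cylinders_setI (R : realType) {d} {T : measurableType d}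
    (P : probability T R) (I : choiceType) (X : I -> {RV P >-> R}) (j : I) :
  setI_closed (cylinders X j).
Proof.
move=> _ _ [s1 [A1 [_ js1 mA1 ->]]] [s2 [A2 [_ js2 mA2 ->]]].
exists (undup (s1 ++ s2)),
  (fun i => (if i \in s1 then A1 i else setT) `&` (if i \in s2 then A2 i else setT)).
split.
- exact: undup_uniq.
- by rewrite mem_undup mem_cat negb_or js1.
- by move=> i; apply: measurableI; case: ifP.
- apply/seteqP; split=> t /=.
    move=> [t1 t2] i _; split; case: ifP => // si; [exact: t1|exact: t2].
  move=> t12; split=> i /= si; have := t12 i; rewrite /= mem_undup mem_cat si ?orbT.
    by move=> /(_ isT) [].
  by move=> /(_ isT) [].
Qed.

Lemma cylinders_measurable (R : realType) {d} {T : measurableType d}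
    (P : probability T R) (I : choiceType) (X : I -> {RV P >-> R}) (j : I) :
  cylinders X j `<=` measurable.
Proof.
move=> _ [s [A [_ _ mA ->]]]; rewrite bigcap_seq.
by apply: bigsetI_measurable => i _; exact: measurable_funPTI.
Qed.

Lemma cylinders_indep (R : realType) {d} {T : measurableType d}
    (P : probability T R) (I : choiceType) (X : I -> {RV P >-> R}) (j : I)
    (C : set T) (B : set R) :
  mutually_independent X -> cylinders X j C -> measurable B ->
  (P (C `&` X j @^-1` B) = P C * P (X j @^-1` B))%E.
Proof.
move=> Xind [s [A [us js mA ->]]] mB.
(* The intersection is again a cylinder, over j :: s. *)
pose A' i := if i == j then B else A i.
have A's i : i \in s -> A' i = A i.
  by rewrite /A'; case: eqP => // -> ij; rewrite ij in js.
rewrite [in RHS]Xind// muleC.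
have -> : P (X j @^-1` B) = P (X j @^-1` A' j) by rewrite /A' eqxx.
rewrite (eq_big_seq (fun i => P (X i @^-1` A' i))); last by move=> i /A's ->.
rewrite -(big_cons _ _ j s xpredT (fun i => P (X i @^-1` A' i))) -Xind/=.
- congr (P _); apply/seteqP; split=> t /=.
    move=> [tA tB] i /=; rewrite inE => /orP[/eqP ->|si]; first by rewrite /A' eqxx.
    by rewrite A's//; exact: tA.
  move=> tA; split=> [i /= si|].
    by have := tA i; rewrite /= inE si orbT A's//; exact.
  by have := tA j; rewrite /= inE eqxx /A' eqxx; exact.
- by rewrite js.
- by move=> i; rewrite /A'; case: ifP.
Qed.

(** For fixed values of the other coordinates, the event is a Borel condition on [X j]
alone, to which [distribution_laplace_shift] applies; integrating over the other
coordinates gives the claim.  The hypothesis on [E], which asks that [E] be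
measurable along every family of measurable functions, lets [E] be seen as an
event on the product of the sigma-algebra of the other coordinates with [R]. *)
Lemma laplace_coord_shift (R : realType) {d} {T : measurableType d}
    (P : probability T R) (I : choiceType) (X : I -> {RV P >-> R}) (j : I)
    (beta c : R) (E : set (I -> R)) :
  mutually_independent X -> 0 < beta -> laplace_distributed beta (X j) ->
  (forall d' (T' : measurableType d') (x : I -> T' -> R),
     (forall i, measurable_fun setT (x i)) -> measurable [set t | E (x ^~ t)]) ->
  (P [set t | E (fun i => X i t)] <= (expR (`|c| / beta))%:E *
   P [set t | E (fun i => X i t + (if i == j then c else 0))%R])%E.
Proof.
move=> Xind b0 Xlap mE.
(* All the coordinates but j are gathered in the single random element V: the
   identity of T, seen as taking values in T equipped with the sigma-algebra
   that they generate. *)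
pose T1 := g_sigma_algebraType (cylinders X j).
have cm := @cylinders_measurable R d T P I X j.
have mid : measurable_fun setT (id : T -> T1).
  move=> _ C mC; rewrite setTI.
  exact: (smallest_sub (@sigma_algebra_measurable _ T) cm).
pose mid' := isMeasurableFun.Build _ _ _ _ _ mid.
pose V : {RV P >-> T1} := HB.pack (id : T -> T1) mid'.
have mX i : i != j -> measurable_fun setT (X i : T1 -> R).
  move=> ij _ B mB; rewrite setTI; apply: sub_sigma_algebra.
  exists [:: i], (fun=> B); split=> //; first by rewrite inE eq_sym.
  by rewrite set_cons1 bigcap_set1.
have VX A B : measurable A -> measurable B ->
    (P (V @^-1` A `&` X j @^-1` B) = P (V @^-1` A) * P (X j @^-1` B))%E.
  move=> mA mB; apply: (@independent_sigma R d T P (cylinders X j)) => //.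
  - exact: cylinders_setI.
  - by exists [::], (fun=> setT); split=> //; rewrite set_nil bigcap_set0.
  - exact: measurable_funPTI.
  - by move=> C CX; exact: cylinders_indep.
pose F c : set (T1 * R) :=
  [set p | E (fun i => if i == j then p.2 + c else X i p.1)].
have mF c' : measurable (F c').
  apply: (mE _ _ (fun i (p : T1 * R) => if i == j then p.2 + c' else X i p.1)) => i.
  case: eqVneq => [_|ij].
    by apply: measurable_funD => //; exact: measurable_snd.
  by apply: measurableT_comp (mX i ij) _; exact: measurable_fst.
have FE c' : [set t | E (fun i => X i t + (if i == j then c' else 0))] =
             [set t | F c' (V t, X j t)].
  apply/seteqP; split=> t /=; rewrite /F/=; congr E; apply/funext => i;
    by case: eqP => [->|]; rewrite ?addr0.
have -> : [set t | E (fun i => X i t)] = [set t | F 0 (V t, X j t)].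
  rewrite -FE; apply/seteqP; split=> t /=; congr E; apply/funext => i;
    by case: ifP; rewrite addr0.
rewrite FE !(joint_lawE VX)//.
have e0 : (0 <= (expR (`|c| / beta))%:E :> \bar R)%E by rewrite lee_fin expR_ge0.
rewrite -ge0_integralZl//; last exact: measurable_fun_xsection.
apply: ge0_le_integral => //.
- exact: measurable_fun_xsection.
- by apply: emeasurable_funM => //; exact: measurable_fun_xsection.
move=> x _.
have -> : xsection (F c) x = (fun y => y + c) @^-1` xsection (F 0) x.
  by apply/seteqP; split=> y /=; rewrite /xsection/= !inE /F/= addr0.
exact: distribution_laplace_shift (measurable_xsection _ _).
Qed.

(** * First crossing of a noisy threshold *)

(** Coordinate [0] of [x] is the noise of the threshold and coordinate [t >= 1]
that of the statistic [a t], as in [noise]. *)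
Definition crosses_at {R : realType} (n : nat) (a x : nat -> R) : Prop :=
  (forall t, (0 < t < n)%N -> a t + x t < x 0%N) /\ x 0%N <= a n + x n.

Lemma measurable_crosses_at (R : realType) (n : nat) (a : nat -> R)
    {d} {T : measurableType d} (x : nat -> T -> R) :
  (forall i, measurable_fun setT (x i)) ->
  measurable [set t | crosses_at n a (x ^~ t)].
Proof.
move=> mx.
have mD i : measurable_fun setT (fun t => a i + x i t) by exact: measurable_funD.
rewrite (_ : [set t | _] = \bigcap_(i in [set i | (0 < i < n)%N])
  [set t | a i + x i t < x 0%N t] `&` [set t | x 0%N t <= a n + x n t]); last first.
  by apply/seteqP; split=> t [].
apply: measurableI.
  apply: bigcap_measurableType => i _.
  rewrite -[X in measurable X]setTI; under eq_set do rewrite -lte_fin.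
  by apply: measurable_lte => //; exact/measurable_EFinP.
by rewrite -[X in measurable X]setTI; exact: measurable_fun_le.
Qed.

Lemma dp_cusum_timeE (R : realType) (T : Type) (l : T -> R) (b : R)
    (X : nat -> T) (z : nat -> R) (w : R) (n : nat) : (0 < n)%N ->
  dp_cusum_time l b X z w = (n%:R)%:E <->
  (forall t, (0 < t < n)%N -> cusum l X t + z t < b + w) /\
  b + w <= cusum l X n + z n.
Proof.
move=> n0; rewrite /dp_cusum_time.
set S := [set t : nat | _].
split=> [infE|[lt_n ge_n]]; last first.
  apply/eqP; rewrite eq_le; apply/andP; split.
    by apply: ereal_inf_lbound; exists n.
  apply: le_ereal_inf_tmp => _ [s [s0 ss] <-]; rewrite lee_fin ler_nat leqNgt.
  by apply/negP => sn; have := lt_n s; rewrite s0 sn ltNge ss => /(_ isT).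
have geS t : S t -> (n <= t)%N.
  move=> St; rewrite -(ler_nat R) -lee_fin -infE.
  by apply: ereal_inf_lbound; exists t.
(* The infimum is attained: otherwise it would be at least n + 1. *)
have Sn : S n.
  apply: contrapT => nSn.
  have : ((n.+1%:R)%:E <= (n%:R)%:E :> \bar R)%E.
    rewrite -infE; apply: le_ereal_inf_tmp => _ [s Ss <-]; rewrite lee_fin ler_nat.
    by rewrite ltn_neqAle geS// andbT; apply/eqP => ns; apply: nSn; rewrite ns.
  by rewrite lee_fin ler_nat ltnn.
split=> [t /andP[t0 tn]|]; last by case: Sn.
by rewrite ltNge; apply: contraL tn => tS; rewrite -leqNgt geS.
Qed.

(** The translated noises of the hypothesis amount to a threshold lower by [c] and
a statistic lower by [c'] at [n].  Undoing this leaves room [c] for the statistics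
to increase before [n], and room [c' - c] for the statistic to decrease at [n]. *)
Lemma crosses_at_shift (R : realType) (n : nat) (a a' x : nat -> R) (c c' : R) :
  (0 < n)%N ->
  (forall t, (0 < t < n)%N -> a' t <= a t + c) -> a n + c - c' <= a' n ->
  crosses_at n a (fun t => x t + (if t == 0%N then - c else 0)
                               + (if t == n then - c' else 0)) ->
  crosses_at n a' x.
Proof.
move=> n0 a'a a'n [lt_n ge_n]; split=> [t /andP[t0 tn]|].
  move: (lt_n t) (a'a t); rewrite t0 tn => /(_ isT) + /(_ isT).
  by rewrite (gtn_eqF t0) (ltn_eqF tn) (ltn_eqF n0) /=; lra.
by move: ge_n; rewrite !eqxx (gtn_eqF n0) (ltn_eqF n0); lra.
Qed.

(** The privacy bound of the sparse vector mechanism, with the costs of the two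
translations kept separate so that either may be zero. *)
Lemma crosses_at_laplace (R : realType) {d} {T : measurableType d}
    (P : probability T R) (X : nat -> {RV P >-> R}) (n : nat) (a a' : nat -> R)
    (beta c c' : R) : (0 < n)%N ->
  mutually_independent X -> 0 < beta ->
  laplace_distributed beta (X 0%N) -> laplace_distributed beta (X n) ->
  0 <= c -> 0 <= c' ->
  (forall t, (0 < t < n)%N -> a' t <= a t + c) -> a n + c - c' <= a' n ->
  (P [set t | crosses_at n a (X ^~ t)] <= (expR ((c + c') / beta))%:E *
   P [set t | crosses_at n a' (X ^~ t)])%E.
Proof.
move=> n0 Xind b0 X0 Xn c0 c'0 a'a a'n.
pose E (x : nat -> R) :=
  crosses_at n a (fun t => x t + (if t == 0%N then - c else 0)).
have mE d' (T' : measurableType d') (x : nat -> T' -> R) :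
    (forall i, measurable_fun setT (x i)) -> measurable [set t | E (x ^~ t)].
  move=> mx; apply: (@measurable_crosses_at R n a _ _
    (fun i t => x i t + (if i == 0%N then - c else 0))) => i.
  exact: measurable_funD.
have mX i : measurable_fun setT (X i) by exact: measurable_funPT.
have S0 := laplace_coord_shift (- c) Xind b0 X0
  (fun d' T' x => @measurable_crosses_at R n a d' T' x).
have Sn := laplace_coord_shift (- c') Xind b0 Xn mE.
apply: le_trans S0 _; rewrite normrN (ger0_norm c0) mulrDl expRD EFinM -muleA.
apply: lee_wpmul2l; first by rewrite lee_fin expR_ge0.
apply: le_trans Sn _; rewrite normrN (ger0_norm c'0).
apply: lee_wpmul2l; first by rewrite lee_fin expR_ge0.
apply: le_measure; rewrite ?inE.
- apply: (mE _ _ (fun i t => X i t + (if i == n then - c' else 0))) => i.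
  exact: measurable_funD.
- exact: measurable_crosses_at.
move=> t /=; rewrite /E => H.
apply: (crosses_at_shift n0 a'a a'n).
by congr crosses_at : H; apply/funext => i; rewrite addrAC.
Qed.

(** * Sensitivity of CUSUM to one data point *)

(** The one-sided form serves twice: [D = 0] gives monotonicity, and [D = Delta]
gives the sensitivity bound. *)
Lemma cusum_le_shift (R : realType) (T : Type) (l : T -> R) (X X' : nat -> T)
    (n i : nat) (D : R) : 0 <= D ->
  (forall t, (0 < t <= n)%N -> t <> i -> l (X' t) = l (X t)) ->
  l (X' i) <= l (X i) + D ->
  forall t, (t <= n)%N -> cusum l X' t <= cusum l X t + D.
Proof.
move=> D0 XX' Xi.
(* The induction needs that nothing is lost before time i, so that D is paid
   only once; afterwards max 0 does not expand the gap. *)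
suff H t : (t <= n)%N -> cusum l X' t <= cusum l X t + (if (i <= t)%N then D else 0).
  by move=> t /H /le_trans; apply; rewrite lerD2l; case: ifP.
elim: t => [_|t IH tn]; first by rewrite /= add0r; case: ifP.
have {IH} := IH (ltnW tn).
rewrite !cusumS.
have max0 (x y e : R) : 0 <= e -> x <= y + e -> Num.max 0 x <= Num.max 0 y + e.
  by rewrite !maxEge; do 2 case: ifP; lra.
have [ti|/eqP ti] := eqVneq t.+1 i.
  rewrite -ti in Xi *; rewrite ltnn leqnn => /(max0 _ _ _ (lexx 0)); lra.
have -> : (i <= t.+1)%N = (i <= t)%N.
  by rewrite [LHS]leq_eqVlt eq_sym (introF eqP ti).
rewrite XX'// => /max0 H.
by rewrite addrAC lerD2r; apply: H; case: ifP.
Qed.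

(** * The range of the log-likelihood ratio *)

Lemma is_density_proportional (R : realType) {d} {T : measurableType d}
    (mu : {measure set T -> \bar R}) (f g : T -> R) (c : R) :
  is_density mu f -> is_density mu g -> 0 <= c ->
  (forall x, g x = c * f x) -> f = g.
Proof.
move=> [mf f0 intf] [mg g0 intg] c0 gE.
have : (\int[mu]_x (g x)%:E = c%:E)%E.
  under eq_integral do rewrite gE EFinM.
  rewrite ge0_integralZl// ?intf ?mule1//.
  - exact/measurable_EFinP.
  - by move=> x _; rewrite lee_fin.
by rewrite intg => -[c1]; apply/funext => x; rewrite gE -c1 mul1r.
Qed.

Lemma le_llr_range (R : realType) (T : Type) (f0 f1 : T -> R) (Delta : R) :
  ereal_sup [set (`|llr f0 f1 x - llr f0 f1 y|)%:E | x in setT & y in setT]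
    = Delta%:E ->
  forall x y, `|llr f0 f1 x - llr f0 f1 y| <= Delta.
Proof.
move=> DE x y; rewrite -lee_fin -DE; apply: ereal_sup_ubound.
by exists x => //; exists y.
Qed.

Lemma llr_range_gt0 (R : realType) {d} {T : measurableType d}
    (mu : {measure set T -> \bar R}) (f0 f1 : T -> R) (Delta : R) (x0 : T) :
  is_density mu f0 -> is_density mu f1 ->
  (forall x, 0 < f0 x) -> (forall x, 0 < f1 x) -> f0 <> f1 ->
  (forall x y, `|llr f0 f1 x - llr f0 f1 y| <= Delta) -> 0 < Delta.
Proof.
move=> df0 df1 f0_gt0 f1_gt0 f01 le_Delta.
have D0 : 0 <= Delta by apply: le_trans (le_Delta x0 x0).
rewrite lt_neqAle D0 andbT; apply/negP => /eqP D0E; apply: f01.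
apply: (is_density_proportional (c := expR (llr f0 f1 x0)) df0 df1).
  exact: expR_ge0.
move=> x; have := le_Delta x0 x.
rewrite -D0E normr_le0 subr_eq0 => /eqP ->.
by rewrite lnK ?posrE ?divr_gt0// divfK// gt_eqF.
Qed.

(** * Privacy of the DP-CUSUM stopping time *)

Theorem theorem1 (R : realType) (k : nat) (f0 f1 : k.-tuple (measurableTypeR R) -> R)
  (f0_density : is_density (lebesgue_tuple k) f0)
  (f1_density : is_density (lebesgue_tuple k) f1)
  (f0_gt0 : forall x, 0 < f0 x) (f1_gt0 : forall x, 0 < f1 x)
  (f0_neq_f1 : f0 <> f1)
  (Delta : R)
  (DeltaE : ereal_sup [set (`|llr f0 f1 x - llr f0 f1 y|)%:E | x in setT & y in setT]
            = Delta%:E)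
  (eps : R) (eps_gt0 : 0 < eps) (b : R)
  (d : measure_display) (Omega : measurableType d) (P : probability Omega R)
  (Z : nat -> {RV P >-> R}) (W : {RV P >-> R})
  (Z_laplace : forall t : nat, (0 < t)%N -> laplace_distributed (2 * Delta / eps) (Z t))
  (W_laplace : laplace_distributed (2 * Delta / eps) W)
  (ZW_indep : mutually_independent (noise Z W))
  (n : nat) (n_gt0 : (0 < n)%N) (X X' : nat -> k.-tuple (measurableTypeR R))
  (XX' : neighboring n X X') :
  (P [set omega | dp_cusum_time (llr f0 f1) b X (fun t => Z t omega) (W omega)
                  = (n%:R)%:E]
   <= (expR eps)%:E *
      P [set omega | dp_cusum_time (llr f0 f1) b X' (fun t => Z t omega) (W omega)
                     = (n%:R)%:E])%E.
Proof.
have le_Delta := le_llr_range DeltaE.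
have D0 : 0 < Delta.
  exact: (llr_range_gt0 (X 0%N) f0_density f1_density).
set l := llr f0 f1 in le_Delta *.
have timeE Y : [set omega | dp_cusum_time l b Y (fun t => Z t omega) (W omega)
      = (n%:R)%:E] =
    [set omega | crosses_at n (fun t => cusum l Y t - b) ((noise Z W) ^~ omega)].
  apply/seteqP; split=> omega /=; rewrite (dp_cusum_timeE _ _ _ _ _ n_gt0).
    move=> [lt_n ge_n]; split=> [[|t] // tn|]; first by have := lt_n _ tn; rewrite /=; lra.
    by rewrite -(prednK n_gt0) /= in ge_n *; lra.
  move=> [lt_n ge_n]; split=> [[|t] // tn|]; first by have := lt_n _ tn; rewrite /=; lra.
  by rewrite -(prednK n_gt0) /= in ge_n *; lra.
rewrite !timeE.
have b0 : 0 < 2 * Delta / eps by rewrite divr_gt0 ?mulr_gt0.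
have ND_n : laplace_distributed (2 * Delta / eps) (noise Z W n).
  by rewrite -(prednK n_gt0); exact: Z_laplace.
case: XX' => i XX'.
have lXX' t : (0 < t <= n)%N -> t <> i -> l (X' t) = l (X t).
  by move=> tn ti; rewrite XX'.
have lX'X t : (0 < t <= n)%N -> t <> i -> l (X t) = l (X' t).
  by move=> tn ti; rewrite XX'.
have := le_Delta (X i) (X' i); rewrite ler_norml => /andP[Dlo Dhi].
have [le_l|/ltW le_l] := leP (l (X i)) (l (X' i)).
- have up := cusum_le_shift (ltW D0) lXX' (ltac:(lra)).
  have lo := cusum_le_shift (lexx 0) lX'X (ltac:(lra)).
  have -> : eps = (Delta + Delta) / (2 * Delta / eps) by field; rewrite !gt_eqF.
  apply: crosses_at_laplace => //; try exact: ltW.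
    by move=> t /andP[_ /ltnW /up]; lra.
  by have := lo n (leqnn n); lra.
- have up := cusum_le_shift (lexx 0) lXX' (ltac:(lra)).
  have lo := cusum_le_shift (ltW D0) lX'X (ltac:(lra)).
  apply: (@le_trans _ _ ((expR ((0 + Delta) / (2 * Delta / eps)))%:E *
    P [set t | crosses_at n (fun t => cusum l X' t - b)%R ((noise Z W) ^~ t)])%E).
    apply: crosses_at_laplace => //; try exact: ltW.
      by move=> t /andP[_ /ltnW /up]; lra.
    by have := lo n (leqnn n); lra.
  apply: lee_wpmul2r => //; rewrite lee_fin ler_expR.
  have -> : (0 + Delta) / (2 * Delta / eps) = eps / 2 by field; rewrite !gt_eqF.
  lra.
Qed.
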